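(* Consider the determining equation for first integrals $I(t,r,\theta,v,\omega)$ of the polar central force equations of motion with radial potential $U(r)$, $$I_t+vI_r+\omega I_\theta+(\omega^2r-U'(r))I_v-\frac{2\omega v}{r}I_\omega=0 .$$ Define $$I_1=\omega r^2,\qquad I_2=\tfrac12v^2+\tfrac12I_1^2r^{-2}+U(r),$$ $$I_3=\theta-I_1\int\frac{\operatorname{sgn}(v)}{\sqrt{2(I_2-U(r))r^4-I_1^2r^2}}\,dr,\qquad I_4=t-\int\frac{\operatorname{sgn}(v)}{\sqrt{2(I_2-U(r))-I_1^2r^{-2}}}\,dr .$$ Then the general solution of the determining equation is given by $I=f(I_1,I_2,I_3,I_4)$, where $f$ is an arbitrary differentiable function and where $I_1,I_2,I_3,I_4$ have physical units of angular momentum, energy, radians, and time, respectively.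
   Context: The polar central force equations of motion with mass $m=1$ and force $F(r)=-U'(r)$ are $\frac{d^2r}{dt^2}=\omega^2r+F(r)$, $\frac{d^2\theta}{dt^2}=-2\omega v/r$, where $v=dr/dt$ is the radial speed and $\omega=d\theta/dt$ is the angular speed. A first integral is a function $I(t,r,\theta,v,\omega)$ with $dI/dt=0$ for all solutions, which is the displayed determining equation. It is solved by the method of characteristics, each constant of integration being a first integral: the indefinite integrals in $I_3$ and $I_4$ are taken with respect to $r$ with $I_1$, $I_2$ treated as constants, using $|v|=\sqrt{2(I_2-U(r))-I_1^2r^{-2}}$.
   Formalization: Stated on open domains with r>0, v≠0 (no mirror points v, −v) where joint level sets of I1,…,I4 are connected and the integration constants make I3, I4 differentiable; globally it fails, e.g. I=sgn(v) for U=0. *)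

(* Defs.v *)
From HB Require Import structures.
From mathcomp Require Import all_boot all_order all_algebra.
From mathcomp Require Import all_classical all_reals all_analysis.

Set Implicit Arguments.
Unset Strict Implicit.
Unset Printing Implicit Defensive.

Import Order.TTheory GRing.Theory Num.Theory.
Import numFieldNormedType.Exports.

Local Open Scope classical_set_scope.
Local Open Scope ring_scope.

(* Points are (t, r, theta, v, omega). *)
Notation phase R := (R * R * R * R * R)%type.

(* At v = 0 the factor sgn(v) and the integrands of I3, I4 degenerate, so
   domains stay away from turning points. *)
Definition regular_domain (R : realType) (U : R -> R) (D : set (phase R))
    : Prop :=
  open D /\
  forall t r th v w : R, D (t, r, th, v, w) ->
    [/\ 0 < r, v != 0 & derivable U r 1].

Definition determining_lhs (R : realType) (U : R -> R) (I : phase R -> R)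
    (t r th v w : R) : R :=
  derive1 (fun s => I (s, r, th, v, w)) t
  + v * derive1 (fun s => I (t, s, th, v, w)) r
  + w * derive1 (fun s => I (t, r, s, v, w)) th
  + (w ^+ 2 * r - derive1 U r) * derive1 (fun s => I (t, r, th, s, w)) v
  - (2 * w * v / r) * derive1 (fun s => I (t, r, th, v, s)) w.

Definition differentiable_on (R : realType) (D : set (phase R))
    (I : phase R -> R) : Prop :=
  forall x, D x -> differentiable I x.

Definition solves_determining_equation (R : realType) (U : R -> R)
    (D : set (phase R)) (I : phase R -> R) : Prop :=
  differentiable_on D I /\
  forall t r th v w : R, D (t, r, th, v, w) -> determining_lhs U I t r th v w = 0.

Definition I1 (R : realType) (x : phase R) : R :=
  let: (t, r, th, v, w) := x in w * r ^+ 2.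

Definition I2 (R : realType) (U : R -> R) (x : phase R) : R :=
  let: (t, r, th, v, w) := x in
  2^-1 * v ^+ 2 + 2^-1 * I1 x ^+ 2 * r ^- 2 + U r.

(* Here sg stands for sgn(v), and c1, c2 for the values of I1, I2. *)
Definition integrand3 (R : realType) (U : R -> R) (sg c1 c2 r : R) : R :=
  sg / Num.sqrt (2 * (c2 - U r) * r ^+ 4 - c1 ^+ 2 * r ^+ 2).

Definition integrand4 (R : realType) (U : R -> R) (sg c1 c2 r : R) : R :=
  sg / Num.sqrt (2 * (c2 - U r) - c1 ^+ 2 * r ^- 2).

(* G c1 c2 is an antiderivative in r of g, the values c1, c2 of I1, I2 being
   held fixed; the constant of integration may depend on c1, c2. *)
Definition indefinite_integral (R : realType) (U : R -> R) (D : set (phase R))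
    (g : R -> R -> R -> R -> R) (G : R -> R -> R -> R) : Prop :=
  forall t r th v w : R, D (t, r, th, v, w) ->
    let c1 := I1 (t, r, th, v, w) in
    let c2 := I2 U (t, r, th, v, w) in
    is_derive r 1 (G c1 c2) (g (Num.sg v) c1 c2 r).

(* I1 and I2 are single functions, but indefinite integrals make I3 and I4
   into families of functions; the four predicates below say that J is a
   possible value of the corresponding quantity on D. *)
Definition is_I1 (R : realType) (U : R -> R) (D : set (phase R))
    (J : phase R -> R) : Prop :=
  forall x, D x -> J x = I1 x.

Definition is_I2 (R : realType) (U : R -> R) (D : set (phase R))
    (J : phase R -> R) : Prop :=
  forall x, D x -> J x = I2 U x.

Definition is_I3 (R : realType) (U : R -> R) (D : set (phase R))
    (J : phase R -> R) : Prop :=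
  exists2 G : R -> R -> R -> R, indefinite_integral U D (integrand3 U) G &
    forall t r th v w : R, D (t, r, th, v, w) ->
      let x := (t, r, th, v, w) in J x = th - I1 x * G (I1 x) (I2 U x) r.

Definition is_I4 (R : realType) (U : R -> R) (D : set (phase R))
    (J : phase R -> R) : Prop :=
  exists2 G : R -> R -> R -> R, indefinite_integral U D (integrand4 U) G &
    forall t r th v w : R, D (t, r, th, v, w) ->
      let x := (t, r, th, v, w) in J x = t - G (I1 x) (I2 U x) r.

(* On a domain where the level sets of (I1, I2, I3, I4), i.e. the pieces of
   trajectories lying in D, may be disconnected, a solution can take different
   values on the pieces and is then only locally a function of I1, ..., I4. *)
Definition connected_level_sets (R : realType) (U : R -> R)
    (D : set (phase R)) (I3 I4 : phase R -> R) : Prop :=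
  forall c : R * R * R * R,
    connected [set x : phase R |
      D x /\ (I1 x, I2 U x, I3 x, I4 x) = c].

(* Change of units: lengths are multiplied by l and times by s, angles are
   pure numbers; with m = 1, the potential has the dimension of a squared
   velocity. *)
Definition rescale_point (R : realType) (l s : R) (x : phase R) : phase R :=
  let: (t, r, th, v, w) := x in (s * t, l * r, th, l / s * v, w / s).

Definition rescale_potential (R : realType) (l s : R) (U : R -> R) : R -> R :=
  fun r => (l / s) ^+ 2 * U (r / l).

(* Exponents of length and time. *)
Definition physical_dimension : Type := (int * int)%type.

Definition angular_momentum_unit : physical_dimension := (2, -1).
Definition energy_unit : physical_dimension := (2, -2).
Definition radian_unit : physical_dimension := (0, 0).
Definition time_unit : physical_dimension := (0, 1).

(* Q U D is the set of possible values of the quantity for the potential U on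
   the domain D; under a change of units these values are multiplied by
   l ^ d.1 * s ^ d.2. *)
Definition has_units (R : realType) (d : physical_dimension)
    (Q : (R -> R) -> set (phase R) -> (phase R -> R) -> Prop) : Prop :=
  forall (l s : R) (U : R -> R) (D : set (phase R)) (J : phase R -> R),
    0 < l -> 0 < s -> regular_domain U D -> Q U D J ->
    Q (rescale_potential l s U) (rescale_point l s @` D)
      (fun x => l ^ d.1 * s ^ d.2 * J (rescale_point l^-1 s^-1 x)).

(* Main.v *)
Require Import Defs.
From HB Require Import structures.
From mathcomp Require Import all_boot all_order all_algebra.
From mathcomp Require Import all_classical all_reals all_analysis.
From mathcomp Require Import ring lra.
Import Order.TTheory GRing.Theory Num.Theory.
Import numFieldNormedType.Exports.
Local Open Scope classical_set_scope.
Local Open Scope ring_scope.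

(* Away from turning points a level set of (I1, I2, I3, I4) is locally a curve
   parametrised by r, namely a trajectory, and along it the left-hand side of
   the determining equation is v times the derivative of I with respect to r.
   Hence functions of I1, ..., I4 are solutions, and a solution is locally
   constant on each level set, so constant when level sets are connected: it
   factors as f o (I1, I2, I3, I4).  No inverse function theorem is needed for
   the differentiability of f (the data are only differentiable, not C^1),
   since (I1, I2, I3, I4) has an explicit differentiable local section with r
   fixed, and f is locally the composite of I with it. *)

(** * Chain rule, the determining equation as a directional derivative, and local constancy *)

Lemma is_derive_diff_comp {R : realType} {V : normedModType R} (I : V -> R)
    (g : R -> V) (s : R) (d : V) :
  is_derive s 1 g d -> differentiable I (g s) ->
  is_derive s 1 (fun u => I (g u)) ('d I (g s) d).
Proof.
move=> [dg eg] dI.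
have dg' : differentiable g s by exact/derivable1_diffP.
have dIg : differentiable (I \o g) s by exact: differentiable_comp.
apply: DeriveDef; first exact/derivable1_diffP.
by rewrite (deriveE _ dIg) diff_comp//= -(deriveE _ dg') eg.
Qed.

Lemma is_derive_pair {R : realType} {V W : normedModType R} (g : R -> V)
    (h : R -> W) (s : R) (dg : V) (dh : W) :
  is_derive s 1 g dg -> is_derive s 1 h dh ->
  is_derive s 1 (fun u => (g u, h u)) (dg, dh).
Proof.
move=> [Dg eg] [Dh eh].
have Dg' : differentiable g s by exact/derivable1_diffP.
have Dh' : differentiable h s by exact/derivable1_diffP.
have Dp := differentiable_pair Dg' Dh'.
apply: DeriveDef; first exact/derivable1_diffP.
by rewrite (deriveE _ Dp) diff_pair//= -!deriveE// eg eh.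
Qed.

(** For differentiable [I] each partial derivative is the differential at a basis vector, so
    linearity collects the five terms into the derivative of [I] along the vector field of the
    equations of motion. *)
Lemma determining_lhsE {R : realType} (U : R -> R) (I : phase R -> R)
    (t r th v w : R) :
  differentiable I (t, r, th, v, w) ->
  determining_lhs U I t r th v w =
  'd I (t, r, th, v, w) (1, v, w, w ^+ 2 * r - derive1 U r, - (2 * w * v / r)).
Proof.
move=> dI; rewrite /determining_lhs !derive1E.
set x := (t, r, th, v, w) in dI *.
have part (g : R -> phase R) (s : R) (d : phase R) : is_derive s 1 g d -> g s = x ->
    'D_1 (fun u => I (g u)) s = 'd I x d.
  move=> dg gx; have := is_derive_diff_comp I g s d dg.
  by rewrite gx => /(_ dI) h; rewrite derive_val.
have -> : 'D_1 (fun s => I (s, r, th, v, w)) t = 'd I x (1, 0, 0, 0, 0).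
  by apply: (part (fun s => (s, r, th, v, w))) => //; do ?apply: is_derive_pair.
have -> : 'D_1 (fun s => I (t, s, th, v, w)) r = 'd I x (0, 1, 0, 0, 0).
  by apply: (part (fun s => (t, s, th, v, w))) => //; do ?apply: is_derive_pair.
have -> : 'D_1 (fun s => I (t, r, s, v, w)) th = 'd I x (0, 0, 1, 0, 0).
  by apply: (part (fun s => (t, r, s, v, w))) => //; do ?apply: is_derive_pair.
have -> : 'D_1 (fun s => I (t, r, th, s, w)) v = 'd I x (0, 0, 0, 1, 0).
  by apply: (part (fun s => (t, r, th, s, w))) => //; do ?apply: is_derive_pair.
have -> : 'D_1 (fun s => I (t, r, th, v, s)) w = 'd I x (0, 0, 0, 0, 1).
  by apply: (part (fun s => (t, r, th, v, s))) => //; do ?apply: is_derive_pair.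
rewrite -mulNr.
have Z (a : R) d : a * 'd I x d = 'd I x (a *: d) by rewrite linearZ.
rewrite !Z -!linearD; congr ('d I x _).
by do 4?[apply: injective_projections]; rewrite /= ?scaler0 ?[_ *: _]mulr1 ?addr0 ?add0r.
Qed.

(** The first-order expansion of [f] at [x] is also one of [g]. Needed because factorisations
    through the first integrals hold only locally, on an open set. *)
Lemma near_eq_differentiable {R : numFieldType} {V W : normedModType R}
    (f g : V -> W) (x : V) :
  {near x, f =1 g} -> differentiable f x -> differentiable g x.
Proof.
move=> fg /diff_locallyP[dfc dfx].
have fg0 : \forall y \near 0, f (y + x) = g (y + x).
  by move: (fg); rewrite (near_shift 0 x) /= subr0.
have gx : g \o shift x = cst (g x) + 'd f x +o_ 0 id.
  apply/eqaddoP => e e0; move/eqaddoP : dfx => /(_ e e0).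
  rewrite -(nbhs_singleton fg).
  by apply: filterS2 fg0 => y /= fgy; rewrite !fctE /= -fgy.
by apply/diff_locallyP; rewrite (diff_unique dfc gx).
Qed.

(** The fibre of [f] through [x] is nonempty, open and closed relative to [A]. The values of [f]
    carry no topology, so the open and the closed set that cut out the fibre are built by hand. *)
Lemma connected_locally_cst {T : topologicalType} {S : Type} (A : set T)
    (f : T -> S) :
  connected A ->
  (forall x, A x -> \forall y \near x, A y -> f y = f x) ->
  {in A &, forall x y, f x = f y}.
Proof.
move=> cA lcf x y /set_mem Ax /set_mem Ay.
suff /seteqP[_ /(_ y Ay)[_ <-//]] : A `&` [set z | f z = f x] = A.
apply: cA; first by exists x.
- exists [set z | \forall u \near z, A u -> f u = f x]°; first exact: open_interior.
  apply/seteqP; split=> z [Az].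
    move=> /= fz; split => //; apply/near_join; move: (lcf _ Az).
    by apply: filterS => u + Au => /(_ Au) ->.
  by move=> /interior_subset /nbhs_singleton /(_ Az) fz; split.
(* Closedness: inside [A], the points off the fibre are those near which [f] avoids the value [f x]
   on [A], and these have an open description. *)
- exists (~` [set z | \forall u \near z, A u -> f u <> f x]°).
    by apply: open_closedC; exact: open_interior.
  apply/seteqP; split=> z [Az] /=.
    move=> fz; split => // /interior_subset /nbhs_singleton /(_ Az).
    exact.
  move=> h; split => //; apply: contrapT => fz; apply: h.
  apply/near_join; move: (lcf _ Az).
  by apply: filterS => u + Au => /(_ Au) ->.
Qed.

(** Mean value theorem on the segment between [a] and [x], which stays in the ball where the
    derivative vanishes; [Num.min] and [Num.max] cover both orders of the endpoints. *)
Lemma near_is_derive_0_cst {R : realType} (f : R -> R) (a : R) :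
  (\forall x \near a, is_derive (x : R) 1 f 0) -> \forall x \near a, f x = f a.
Proof.
move=> /nbhs_ballP[e /= e0 df]; apply/nbhs_ballP; exists e => //= x.
rewrite /ball/= => aex.
have dfx (z : R) : z \in `[Num.min a x, Num.max a x] -> is_derive z 1 f 0.
  rewrite in_itv/= => zax; apply: df; rewrite /ball/=; move: aex zax.
  by rewrite !ltr_norml; case: (leP a x) => ?; lra.
have le_ax : Num.min a x <= Num.max a x by rewrite ge_min le_max lexx.
have fax : {within `[Num.min a x, Num.max a x], continuous f}.
  by apply: derivable_within_continuous => z /dfx[].
have dfx' (z : R) : z \in `]Num.min a x, Num.max a x[ -> is_derive z 1 f (cst 0 z).
  by move=> zax; apply: dfx; exact: subset_itv_oo_cc.
have [c _] := MVT_segment le_ax dfx' fax.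
rewrite mul0r => /eqP; rewrite subr_eq0 => /eqP.
by case: (leP a x) => _ // ->.
Qed.

Lemma near_sg {R : realType} (x : phase R) : x.1.2 != 0 ->
  \forall y \near x, Num.sg y.1.2 = Num.sg x.1.2.
Proof.
have cv : (y.1.2 @[y --> x]) --> x.1.2.
  exact: (cvg_comp _ _ cvg_fst cvg_snd).
rewrite neq_lt => /orP[] x0.
- apply: filterS (cvgr_lt x.1.2 cv 0 x0) => y y0.
  by rewrite !ltr0_sg.
- apply: filterS (cvgr_gt x.1.2 cv 0 x0) => y y0.
  by rewrite !gtr0_sg.
Qed.

(** * Points with prescribed angular momentum and energy *)

(** The energy relation [I2 = c2], with [I1 = c1], solved for [v]; [sg] selects the outgoing or
    incoming branch. *)
Definition radial_speed {R : realType} (U : R -> R) (sg c1 c2 r : R) : R :=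
  sg * Num.sqrt (2 * (c2 - U r) - c1 ^+ 2 * r ^- 2).

Definition level_point {R : realType} (U : R -> R) (sg c1 c2 t r th : R)
    : phase R :=
  (t, r, th, radial_speed U sg c1 c2 r, c1 * r ^- 2).

Lemma is_derive_exprN2 {R : realType} (r : R) : r != 0 ->
  is_derive r 1 (fun s : R => s ^- 2) (- 2 * r ^- 3).
Proof.
move=> r0.
have d2 : is_derive r 1 (fun s : R => s ^+ 2) (2 * r).
  have /= := is_deriveX (f := id) 2 (is_derive_id r 1).
  by rewrite [_ *: _]mulr1.
have r20 : r ^+ 2 != 0 by rewrite expf_neq0.
have dV := is_deriveV (f := fun s : R => s ^+ 2) r20 d2; apply: (is_derive_eq dV).
by rewrite /GRing.scale /=; field.
Qed.

Section level_curves.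
Context {R : realType}.
Implicit Types (U : R -> R).

Lemma sqr_sg_neq0 (v : R) : v != 0 -> Num.sg v ^+ 2 = 1.
Proof. by move=> v0; rewrite sqr_sg v0. Qed.

Lemma radial_speed_sg U (t r th v w : R) : 0 < r -> v != 0 ->
  let x := (t, r, th, v, w) in
  radial_speed U (Num.sg v) (I1 x) (I2 U x) r = v.
Proof.
move=> r0 v0 /=; rewrite /radial_speed.
have -> : 2 * (2^-1 * v ^+ 2 + 2^-1 * (w * r ^+ 2) ^+ 2 / r ^+ 2 + U r - U r)
    - (w * r ^+ 2) ^+ 2 / r ^+ 2 = v ^+ 2 by field; rewrite gt_eqF.
by rewrite sqrtr_sqr -numEsg.
Qed.

Lemma level_point_id U (t r th v w : R) : 0 < r -> v != 0 ->
  let x := (t, r, th, v, w) in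
  level_point U (Num.sg v) (I1 x) (I2 U x) t r th = x.
Proof.
move=> r0 v0 /=; have /= e := radial_speed_sg U t r th v w r0 v0.
rewrite /level_point e; congr (_, _, _, _, _).
by rewrite mulfK// expf_neq0// gt_eqF.
Qed.

(** [Num.sqrt] is 0 at nonpositive arguments, so a nonzero speed already certifies that the radicand
    is positive. *)
Lemma radicand_gt0 U (sg c1 c2 r : R) : radial_speed U sg c1 c2 r != 0 ->
  0 < 2 * (c2 - U r) - c1 ^+ 2 * r ^- 2.
Proof.
rewrite /radial_speed; case: ltP => // h.
by rewrite ler0_sqrtr// mulr0 eqxx.
Qed.

Lemma I1_level_point U (sg c1 c2 t r th : R) : 0 < r ->
  I1 (level_point U sg c1 c2 t r th) = c1.
Proof. by move=> r0; rewrite /= divfK// expf_neq0// gt_eqF. Qed.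

Lemma I2_level_point U (sg c1 c2 t r th : R) : 0 < r -> sg ^+ 2 = 1 ->
  radial_speed U sg c1 c2 r != 0 ->
  I2 U (level_point U sg c1 c2 t r th) = c2.
Proof.
move=> r0 s1 /radicand_gt0 X0.
rewrite /I2 I1_level_point//= /radial_speed exprMn s1 sqr_sqrtr ?ltW//.
by field; rewrite gt_eqF.
Qed.

Lemma sg_radial_speed U (sg c1 c2 r : R) : sg ^+ 2 = 1 ->
  radial_speed U sg c1 c2 r != 0 -> Num.sg (radial_speed U sg c1 c2 r) = sg.
Proof.
move=> s1 /radicand_gt0 X0; rewrite /radial_speed sgrM.
rewrite [X in _ * X]gtr0_sg ?sqrtr_gt0// mulr1.
move/eqP : s1; rewrite sqrf_eq1 => /orP[]/eqP->; first exact: sgr1.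
exact: sgrN1.
Qed.

Lemma integrand4E U (sg c1 c2 r : R) : sg ^+ 2 = 1 ->
  integrand4 U sg c1 c2 r = (radial_speed U sg c1 c2 r)^-1.
Proof.
move=> s1; rewrite /integrand4 /radial_speed [RHS]invfM; congr (_ * _).
by move/eqP : s1; rewrite sqrf_eq1 => /orP[]/eqP->; rewrite ?invrN invr1.
Qed.

(** The radicand of [integrand3] is [r ^+ 4] times that of [integrand4]. Multiplied by [c1], the
    integrand is therefore omega / v, the slope of theta against r. *)
Lemma integrand3E U (sg c1 c2 r : R) : sg ^+ 2 = 1 -> 0 < r ->
  integrand3 U sg c1 c2 r = (radial_speed U sg c1 c2 r)^-1 * r ^- 2.
Proof.
move=> s1 r0; rewrite -integrand4E// /integrand3 /integrand4.
have -> : 2 * (c2 - U r) * r ^+ 4 - c1 ^+ 2 * r ^+ 2 =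
    (r ^+ 2) ^+ 2 * (2 * (c2 - U r) - c1 ^+ 2 * r ^- 2).
  by field; rewrite gt_eqF.
rewrite sqrtrM ?sqr_ge0// sqrtr_sqr ger0_norm ?sqr_ge0//.
by rewrite invfM mulrA mulrAC.
Qed.

Lemma is_derive_radial_speed U (sg c1 c2 r : R) : sg ^+ 2 = 1 -> 0 < r ->
  derivable U r 1 -> radial_speed U sg c1 c2 r != 0 ->
  is_derive r 1 (radial_speed U sg c1 c2)
    ((c1 ^+ 2 * r ^- 3 - derive1 U r) / radial_speed U sg c1 c2 r).
Proof.
move=> s1 r0 dU v0; have X0 := radicand_gt0 _ _ _ _ _ v0.
have rn0 : r != 0 by rewrite gt_eqF.
have dU' : is_derive r 1 U (derive1 U r) by rewrite derive1E; exact: DeriveDef.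
have dX : is_derive r 1 (fun s => 2 * (c2 - U s) - c1 ^+ 2 * s ^- 2)
    (- 2 * derive1 U r + 2 * c1 ^+ 2 * r ^- 3).
  apply: (is_derive_eq (is_deriveB (is_deriveZ 2 (is_deriveB
    (is_derive_cst c2 r 1) dU')) (is_deriveZ (c1 ^+ 2) (is_derive_exprN2 _ rn0)))).
  by rewrite /GRing.scale /=; ring.
have dS := is_derive1_comp
  (g := fun s => 2 * (c2 - U s) - c1 ^+ 2 * s ^- 2) (is_derive1_sqrt X0) dX.
have dV : is_derive r 1 (radial_speed U sg c1 c2) _ := is_deriveZ sg dS.
apply: (is_derive_eq dV).
(* One side carries [sg] as a factor and the other as a divisor; multiplying by [sg ^+ 2 = 1] makes
   the equality an identity of fractions. *)
rewrite -[RHS]mulr1 -[X in _ = _ * X]s1 /radial_speed /GRing.scale /=.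
set q := Num.sqrt _; have q0 : q != 0 by rewrite gt_eqF// sqrtr_gt0.
have sg0 : sg != 0 by rewrite -sqrf_eq0 s1 oner_eq0.
by field; rewrite rn0 q0 sg0.
Qed.
End level_curves.

(** * Differentiation along curves parametrised by r *)

Section along.
Context {R : realType}.
Implicit Types (U : R -> R) (J : phase R -> R).

Lemma is_derive_level_curve U (sg c1 c2 r dT dTh : R) (T Th : R -> R) :
  sg ^+ 2 = 1 -> 0 < r -> derivable U r 1 -> radial_speed U sg c1 c2 r != 0 ->
  is_derive r 1 T dT -> is_derive r 1 Th dTh ->
  is_derive r 1 (fun s => level_point U sg c1 c2 (T s) s (Th s))
    (dT, 1, dTh, (c1 ^+ 2 * r ^- 3 - derive1 U r) / radial_speed U sg c1 c2 r,
     c1 * (- 2 * r ^- 3)).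
Proof.
move=> s1 r0 dU v0 hT hTh.
have rn0 : r != 0 by rewrite gt_eqF.
have dV := is_derive_radial_speed _ _ _ _ _ s1 r0 dU v0.
have dW := is_deriveZ c1 (is_derive_exprN2 _ rn0).
have d12 := is_derive_pair T id _ _ _ hT (is_derive_id r 1).
have d123 := is_derive_pair (fun s => (T s, s)) Th _ _ _ d12 hTh.
have d1234 := is_derive_pair (fun s => (T s, s, Th s)) _ _ _ _ d123 dV.
exact (is_derive_pair (fun s => (T s, s, Th s, radial_speed U sg c1 c2 s))
  _ _ _ _ d1234 dW).
Qed.

(** With dt/dr = 1 / v and dtheta/dr = omega / v, the tangent of the curve is 1 / v times the vector
    of the equations of motion, so [determining_lhsE] identifies the derivative. *)
Lemma is_derive_along_level_curve U J (sg c1 c2 r : R) (T Th : R -> R) :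
  let v := radial_speed U sg c1 c2 r in
  let w := c1 * r ^- 2 in
  sg ^+ 2 = 1 -> 0 < r -> derivable U r 1 -> v != 0 ->
  is_derive r 1 T v^-1 -> is_derive r 1 Th (v^-1 * w) ->
  differentiable J (T r, r, Th r, v, w) ->
  is_derive r 1 (fun s => J (level_point U sg c1 c2 (T s) s (Th s)))
    (v^-1 * determining_lhs U J (T r) r (Th r) v w).
Proof.
move=> v w s1 r0 dU v0 hT hTh dJ.
have rn0 : r != 0 by rewrite gt_eqF.
have dg := is_derive_level_curve _ _ _ _ _ _ _ _ _ s1 r0 dU v0 hT hTh.
apply: (is_derive_eq (is_derive_diff_comp J
  (fun s => level_point U sg c1 c2 (T s) s (Th s)) _ _ dg dJ)).
rewrite determining_lhsE//.
have Z (a : R) (d : phase R) : a * 'd J (T r, r, Th r, v, w) d =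
  'd J (T r, r, Th r, v, w) (a *: d) by rewrite linearZ.
rewrite Z; congr ('d J _ _).
do 4?[apply: injective_projections]; rewrite /= ?[_ *: _]mulr1 -/v//.
- by rewrite [RHS]mulVf.
- by rewrite [RHS]mulrC; congr (_ / _); rewrite /w; field.
- by rewrite /GRing.scale /= /w; field; rewrite rn0 v0.
Qed.

End along.

(** * Differentiability of [I1], [I2] and [level_point] *)

Section differentiable_projections.
Context {K : numFieldType} {T V W : normedModType K}.

Lemma differentiable_fst (f : T -> V * W) (x : T) :
  differentiable f x -> differentiable (fun y => (f y).1) x.
Proof.
move=> df; apply: differentiable_comp df _.
by apply: linear_differentiable => y; exact: cvg_fst.
Qed.

Lemma differentiable_snd (f : T -> V * W) (x : T) :
  differentiable f x -> differentiable (fun y => (f y).2) x.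
Proof.
move=> df; apply: differentiable_comp df _.
by apply: linear_differentiable => y; exact: cvg_snd.
Qed.

End differentiable_projections.

Lemma differentiable_I1 {R : realType} (x : phase R) : differentiable (@I1 R) x.
Proof.
have -> : @I1 R = (fun y => y.2 * y.1.1.1.2 ^+ 2).
  by apply/funext => -[[[[t r] th] v] w].
have d0 : differentiable (id : phase R -> phase R) x by [].
have dr := differentiable_snd _ _
  (differentiable_fst _ _ (differentiable_fst _ _ (differentiable_fst _ _ d0))).
exact (differentiableM (differentiable_snd _ _ d0) (differentiableX 1 dr)).
Qed.

Lemma differentiable_I2 {R : realType} (U : R -> R) (x : phase R) :
  x.1.1.1.2 != 0 -> derivable U x.1.1.1.2 1 -> differentiable (I2 U) x.
Proof.
move=> r0 dU.
have -> : I2 U = (fun y => 2^-1 * y.1.2 ^+ 2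
    + 2^-1 * I1 y ^+ 2 * y.1.1.1.2 ^- 2 + U y.1.1.1.2).
  by apply/funext => -[[[[t r] th] v] w].
have d0 : differentiable (id : phase R -> phase R) x by [].
have dv := differentiable_snd _ _ (differentiable_fst _ _ d0).
have dr := differentiable_snd _ _
  (differentiable_fst _ _ (differentiable_fst _ _ (differentiable_fst _ _ d0))).
have dU' : differentiable U x.1.1.1.2 by exact/derivable1_diffP.
have dUr := differentiable_comp dr dU'.
have r20 : x.1.1.1.2 ^+ 2 != 0 by rewrite expf_neq0.
have drV := differentiableV (differentiableX 1 dr) r20.
have dc : differentiable (cst (2^-1 : R) : phase R -> R) x.
  exact: differentiable_cst.
have dI1 := differentiableX 1 (differentiable_I1 x).
exact (differentiableD (differentiableD
  (differentiableM dc (differentiableX 1 dv))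
  (differentiableM (differentiableM dc dI1) drV)) dUr).
Qed.

(** Since [r] is fixed, [U] enters only through the constant [U r]; positivity of the radicand makes
    the square root differentiable. *)
Lemma differentiable_level_point {R : realType} {T : normedModType R}
    (U : R -> R) (sg r : R) (c1 c2 t th : T -> R) (x : T) :
  differentiable c1 x -> differentiable c2 x ->
  differentiable t x -> differentiable th x ->
  0 < 2 * (c2 x - U r) - c1 x ^+ 2 * r ^- 2 ->
  differentiable (fun y => level_point U sg (c1 y) (c2 y) (t y) r (th y)) x.
Proof.
move=> d1 d2 dt dth X0.
have dc (a : R) : differentiable (cst a : T -> R) x by exact: differentiable_cst.
have dX : differentiable (fun y => 2 * (c2 y - U r) - c1 y ^+ 2 * r ^- 2) x.
  exact (differentiableB (differentiableM (dc 2) (differentiableB d2 (dc (U r))))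
    (differentiableM (differentiableX 1 d1) (dc (r ^- 2)))).
have dS : differentiable (Num.sqrt : R -> R) (2 * (c2 x - U r) - c1 x ^+ 2 * r ^- 2).
  by apply/derivable1_diffP; have [] := is_derive1_sqrt X0.
have dV := differentiableM (dc sg) (differentiable_comp dX dS).
have dW := differentiableM d1 (dc (r ^- 2)).
exact (differentiable_pair (differentiable_pair (differentiable_pair
  (differentiable_pair dt (dc r)) dth) dV) dW).
Qed.

(** * Trajectories and the factorisation of solutions through the four first integrals *)

Section first_integrals.
Context {R : realType} (U : R -> R) (D : set (phase R)) (I3 I4 : phase R -> R).
Context (G3 G4 : R -> R -> R -> R).
Hypothesis regD : regular_domain U D.
Hypothesis G3P : indefinite_integral U D (integrand3 U) G3.
Hypothesis G4P : indefinite_integral U D (integrand4 U) G4.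
Hypothesis I3P : forall t r th v w : R, D (t, r, th, v, w) ->
  let x := (t, r, th, v, w) in I3 x = th - I1 x * G3 (I1 x) (I2 U x) r.
Hypothesis I4P : forall t r th v w : R, D (t, r, th, v, w) ->
  let x := (t, r, th, v, w) in I4 x = t - G4 (I1 x) (I2 U x) r.

Let Phi (x : phase R) := (I1 x, I2 U x, I3 x, I4 x).

(* The curve on which (I1, I2, I3, I4) = c, parametrised by r. *)
Definition trajectory (sg : R) (c : R * R * R * R) (s : R) : phase R :=
  let: (c1, c2, c3, c4) := c in
  level_point U sg c1 c2 (c4 + G4 c1 c2 s) s (c3 + c1 * G3 c1 c2 s).

Lemma level_point_dom (sg c1 c2 t r th : R) :
  D (level_point U sg c1 c2 t r th) ->
  [/\ 0 < r, radial_speed U sg c1 c2 r != 0 & derivable U r 1].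
Proof. by case: regD => _; apply. Qed.

Lemma trajectory_id (t r th v w : R) : D (t, r, th, v, w) ->
  let x := (t, r, th, v, w) in trajectory (Num.sg v) (Phi x) r = x.
Proof.
move=> Dx /=; have [r0 v0 _] := regD.2 _ _ _ _ _ Dx.
rewrite /trajectory /Phi I3P// I4P// !subrK.
exact: level_point_id.
Qed.

Lemma first_integrals_level_point (sg c1 c2 t r th : R) : sg ^+ 2 = 1 ->
  D (level_point U sg c1 c2 t r th) ->
  Phi (level_point U sg c1 c2 t r th) =
  (c1, c2, th - c1 * G3 c1 c2 r, t - G4 c1 c2 r).
Proof.
move=> s1 Dx; have [r0 v0 _] := level_point_dom _ _ _ _ _ _ Dx.
rewrite /Phi I3P// I4P//.
rewrite -/(level_point U sg c1 c2 t r th).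
by rewrite I1_level_point// I2_level_point.
Qed.

Lemma first_integrals_trajectory (sg : R) c (s : R) : sg ^+ 2 = 1 ->
  D (trajectory sg c s) -> Phi (trajectory sg c s) = c.
Proof.
case: c => [[[c1 c2] c3] c4] s1 Dx.
by rewrite first_integrals_level_point// !addrK.
Qed.

(** [indefinite_integral] speaks only of constants attained as [I1], [I2] at a point of [D], with
    the sign of [v] there; [level_point] is such a point for [c1], [c2], [sg]. *)
Lemma is_derive_antiderivatives (sg c1 c2 t r th : R) : sg ^+ 2 = 1 ->
  D (level_point U sg c1 c2 t r th) ->
  let v := radial_speed U sg c1 c2 r in
  is_derive r 1 (G3 c1 c2) (v^-1 * r ^- 2) /\ is_derive r 1 (G4 c1 c2) v^-1.
Proof.
move=> s1 Dx; have [r0 v0 _] := level_point_dom _ _ _ _ _ _ Dx.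
set p := level_point U sg c1 c2 t r th in Dx.
have I1p : I1 p = c1 by exact: I1_level_point.
have I2p : I2 U p = c2 by exact: I2_level_point.
have h3 : is_derive r 1 (G3 (I1 p) (I2 U p)) _ := G3P _ _ _ _ _ Dx.
have h4 : is_derive r 1 (G4 (I1 p) (I2 U p)) _ := G4P _ _ _ _ _ Dx.
move: h3 h4; rewrite -/(level_point U sg c1 c2 t r th) -/p I1p I2p.
by rewrite sg_radial_speed// integrand3E// integrand4E.
Qed.

(** The antiderivatives [G4] and [G3] give t and theta exactly the slopes 1 / v and omega / v
    required along a level curve. *)
Lemma is_derive_trajectory (J : phase R -> R) (sg : R) c (s t r th v w : R) :
  trajectory sg c s = (t, r, th, v, w) ->
  sg ^+ 2 = 1 -> D (t, r, th, v, w) -> differentiable J (t, r, th, v, w) ->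
  is_derive s 1 (fun u => J (trajectory sg c u))
    (v^-1 * determining_lhs U J t r th v w).
Proof.
case: c => [[[c1 c2] c3] c4] [<- <- <- <- <-] s1 Dx dJ.
have [r0 v0 dU] := level_point_dom _ _ _ _ _ _ Dx.
have [d3 d4] := is_derive_antiderivatives _ _ _ _ _ _ s1 Dx.
apply: (is_derive_along_level_curve U J sg c1 c2 s
  (fun u => c4 + G4 c1 c2 u) (fun u => c3 + c1 * G3 c1 c2 u)) => //.
- apply: (is_derive_eq (is_deriveD (is_derive_cst c4 s 1) d4)).
  by rewrite add0r.
- apply: (is_derive_eq (is_deriveD (is_derive_cst c3 s 1) (is_deriveZ c1 d3))).
  by rewrite add0r /GRing.scale /= mulrCA.
Qed.

Lemma near_trajectory (sg : R) c (s : R) : sg ^+ 2 = 1 ->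
  D (trajectory sg c s) -> \forall u \near s, D (trajectory sg c u).
Proof.
case: c => [[[c1 c2] c3] c4] s1 Dx.
have [r0 v0 dU] := level_point_dom _ _ _ _ _ _ Dx.
have [d3 d4] := is_derive_antiderivatives _ _ _ _ _ _ s1 Dx.
have dT := is_deriveD (is_derive_cst c4 s 1) d4.
have dTh := is_deriveD (is_derive_cst c3 s 1) (is_deriveZ c1 d3).
have [dg _] := is_derive_level_curve U sg c1 c2 s _ _
  (fun u => c4 + G4 c1 c2 u) (fun u => c3 + c1 * G3 c1 c2 u) s1 r0 dU v0 dT dTh.
have cg : {for s, continuous (trajectory sg (c1, c2, c3, c4))}.
  by apply: differentiable_continuous; exact/derivable1_diffP.
have nD : nbhs (trajectory sg (c1, c2, c3, c4) s) D.
  by move: regD.1; rewrite openE => oD; exact: oD.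
exact: cg nD.
Qed.

Lemma trajectory_cst (I : phase R -> R) (sg : R) c (s : R) : sg ^+ 2 = 1 ->
  solves_determining_equation U D I -> D (trajectory sg c s) ->
  \forall u \near s, I (trajectory sg c u) = I (trajectory sg c s).
Proof.
move=> s1 [dI lhsI] Dx.
apply: (near_is_derive_0_cst (fun u => I (trajectory sg c u))).
apply: filterS (near_trajectory _ _ _ s1 Dx) => u Du.
case ex : (trajectory sg c u) (Du) => [[[[t r] th] v] w] Du'.
by have := is_derive_trajectory I _ _ _ _ _ _ _ _ ex s1 Du' (dI _ Du');
  rewrite lhsI// mulr0.
Qed.

(** A point [y] near [x] has the same sign of [v]; if its first integrals also agree, [y] lies on
    the trajectory through [x], at a nearby value of r, where [trajectory_cst] applies. *)
Lemma solution_locally_cst (I : phase R -> R) (x : phase R) :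
  solves_determining_equation U D I -> D x ->
  \forall y \near x, D y /\ Phi y = Phi x -> I y = I x.
Proof.
move: x => [[[[t r] th] v] w] sI Dx.
have [r0 v0 _] := regD.2 _ _ _ _ _ Dx.
have s1 := sqr_sg_neq0 v v0.
set x := (t, r, th, v, w) in Dx *.
have ex : trajectory (Num.sg v) (Phi x) r = x := trajectory_id _ _ _ _ _ Dx.
have Dt : D (trajectory (Num.sg v) (Phi x) r) by rewrite ex.
have cr : y.1.1.1.2 @[y --> x] --> r.
  exact: (cvg_comp _ _ (cvg_comp _ _ (cvg_comp _ _ cvg_fst cvg_fst) cvg_fst) cvg_snd).
apply: filterS2 (near_sg x v0) (cr _ (trajectory_cst I _ _ _ s1 sI Dt)).
move=> [[[[t' r'] th'] v'] w'].
set y := (t', r', th', v', w') => sv It [Dy ey].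
have ey' : trajectory (Num.sg y.1.2) (Phi y) r' = y :=
  trajectory_id _ _ _ _ _ Dy.
by rewrite -ey' ey sv It ex.
Qed.

(* Keeping r fixed, c1 and c2 determine omega and v explicitly; c3 and c4 are
   then reached by translating theta and t, and the antiderivatives that this
   involves are differentiable in (c1, c2) because I3 and I4 are. *)
Lemma local_section (x : phase R) :
  differentiable_on D I3 -> differentiable_on D I4 -> D x ->
  exists sigma : R * R * R * R -> phase R,
    [/\ differentiable sigma (Phi x), sigma (Phi x) = x &
        \forall c \near Phi x, D (sigma c) /\ Phi (sigma c) = c].
Proof.
move: x => [[[[t r] th] v] w] dI3 dI4 Dx.
have [r0 v0 _] := regD.2 _ _ _ _ _ Dx.
have s1 := sqr_sg_neq0 v v0.
set x := (t, r, th, v, w) in Dx *.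
pose sg := Num.sg v.
have ex : level_point U sg (I1 x) (I2 U x) t r th = x := level_point_id _ _ _ _ _ _ r0 v0.
have Vx : radial_speed U sg (I1 x) (I2 U x) r = v := radial_speed_sg _ _ _ _ _ _ r0 v0.
have X0 : 0 < 2 * (I2 U x - U r) - I1 x ^+ 2 * r ^- 2.
  by apply: (radicand_gt0 _ sg); rewrite Vx.
have d0 : differentiable (id : R * R * R * R -> R * R * R * R) (Phi x) by [].
have d4 := differentiable_snd _ _ d0.
have d3 := differentiable_snd _ _ (differentiable_fst _ _ d0).
have d2 := differentiable_snd _ _ (differentiable_fst _ _ (differentiable_fst _ _ d0)).
have d1 := differentiable_fst _ _ (differentiable_fst _ _ (differentiable_fst _ _ d0)).
have dc (a : R) : differentiable (cst a : R * R * R * R -> R) (Phi x).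
  exact: differentiable_cst.
(* A probe with t and theta frozen: where [q c] lies in [D], [t - I4 (q c)] is [G4 c1 c2 r] and
   [th - I3 (q c)] is [c1 * G3 c1 c2 r]. So [T] and [Th] are the time and angle of the trajectory
   with constants [c]. *)
pose q (c : R * R * R * R) := level_point U sg c.1.1.1 c.1.1.2 t r th.
have dq : differentiable q (Phi x).
  exact: (differentiable_level_point U sg r _ _ _ _ _ d1 d2 (dc t) (dc th)).
have qx : q (Phi x) = x by [].
have Dq : D (q (Phi x)) by rewrite qx.
pose T (c : R * R * R * R) := c.2 + (t - I4 (q c)).
pose Th (c : R * R * R * R) := c.1.2 + (th - I3 (q c)).
have dT : differentiable T (Phi x).
  exact (differentiableD d4 (differentiableB (dc t) (differentiable_comp dq (dI4 _ Dq)))).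
have dTh : differentiable Th (Phi x).
  exact (differentiableD d3 (differentiableB (dc th) (differentiable_comp dq (dI3 _ Dq)))).
pose sigma (c : R * R * R * R) := level_point U sg c.1.1.1 c.1.1.2 (T c) r (Th c).
have dsigma : differentiable sigma (Phi x).
  exact: (differentiable_level_point U sg r _ _ _ _ _ d1 d2 dT dTh).
have sx : sigma (Phi x) = x.
  by rewrite /sigma /T /Th qx /= [I4 x + _]addrC [I3 x + _]addrC !subrK.
have nD (f : R * R * R * R -> phase R) : differentiable f (Phi x) ->
    f (Phi x) = x -> \forall c \near Phi x, D (f c).
  move=> /differentiable_continuous cf fx.
  have nD : nbhs (f (Phi x)) D by rewrite fx; move: regD.1; rewrite openE => /(_ _ Dx).
  exact: cf nD.
exists sigma; split => //.
apply: filterS2 (nD q dq qx) (nD sigma dsigma sx).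
move=> [[[c1 c2] c3] c4] Dqc Dsc; split => //.
have := first_integrals_level_point _ _ _ _ _ _ s1 Dqc.
rewrite -/(q (c1, c2, c3, c4)) => -[_ _ e3 e4].
rewrite first_integrals_level_point// /T /Th e3 e4 /=.
by congr (_, _, _, _); ring.
Qed.

Lemma general_solution (I : phase R -> R) :
  differentiable_on D I3 -> differentiable_on D I4 ->
  connected_level_sets U D I3 I4 ->
  solves_determining_equation U D I <->
  exists f : R * R * R * R -> R,
    (forall x, D x -> differentiable f (Phi x)) /\
    (forall x, D x -> I x = f (Phi x)).
Proof.
move=> dI3 dI4 conn; split=> [sI|[f [df If]]].
  have Icst x y : D x -> D y -> Phi x = Phi y -> I x = I y.
    move=> Dx Dy exy.
    apply: (connected_locally_cst _ I (conn (Phi y))); rewrite ?inE//=.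
    move=> z [Dz ez]; apply: filterS (solution_locally_cst _ _ sI Dz).
    move=> u Iu [Du eu]; apply: Iu; split => //.
    by rewrite /Phi ez eu.
  (* Any preimage in [D] may be chosen, by [Icst]. The default 0 is taken only outside the image of
     [D], and by [local_section] that image is a neighbourhood of each of its points. *)
  pose f c := if pselect (exists2 x, D x & Phi x = c) is left ex
    then I (projT1 (cid2 ex)) else 0.
  have fP x : D x -> f (Phi x) = I x.
    move=> Dx; rewrite /f; case: pselect => [ex|]; last by case; exists x.
    by case: cid2 => y Dy eyx /=; exact: Icst.
  exists f; split=> x Dx; last by rewrite fP.
  have [sigma [dsigma sx ns]] := local_section x dI3 dI4 Dx.
  apply: (near_eq_differentiable (I \o sigma)).
    by apply: filterS ns => c [Dc ec] /=; rewrite -fP// ec.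
  apply: differentiable_comp dsigma _; rewrite sx; exact: sI.1.
have dI : differentiable_on D I.
  move=> [[[[t r] th] v] w] Dx; have [r0 v0 dU] := regD.2 _ _ _ _ _ Dx.
  set x := (t, r, th, v, w) in Dx *.
  have dPhi : differentiable Phi x.
    have rn0 : x.1.1.1.2 != 0 by rewrite gt_eqF.
    exact (differentiable_pair (differentiable_pair (differentiable_pair
      (differentiable_I1 x) (differentiable_I2 U x rn0 dU)) (dI3 x Dx)) (dI4 x Dx)).
  apply: (near_eq_differentiable (f \o Phi)).
    move: regD.1; rewrite openE => /(_ _ Dx).
    by apply: filterS => y Dy /=; rewrite If.
  by apply: differentiable_comp dPhi _; exact: df.
split=> // t r th v w Dx; have [r0 v0 dU] := regD.2 _ _ _ _ _ Dx.
have s1 := sqr_sg_neq0 v v0.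
have ex : trajectory (Num.sg v) (Phi (t, r, th, v, w)) r = (t, r, th, v, w) :=
  trajectory_id _ _ _ _ _ Dx.
have Dt := Dx; rewrite -ex in Dt.
have [_ dIt] := is_derive_trajectory I _ _ _ _ _ _ _ _ ex s1 Dx (dI _ Dx).
(* Along the trajectory [I] is [f] at a fixed argument, hence constant near [r]; its derivative is
   also the left-hand side divided by the nonzero [v]. *)
have : 'D_1 (fun u => I (trajectory (Num.sg v) (Phi (t, r, th, v, w)) u)) r = 0.
  rewrite -(derive_cst (I (t, r, th, v, w)) r 1).
  apply: near_eq_derive; apply: filterS (near_trajectory _ _ _ s1 Dt) => u Du.
  by rewrite If// first_integrals_trajectory// -If.
by rewrite dIt => /eqP; rewrite mulf_eq0 invr_eq0 (negbTE v0) => /eqP.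
Qed.

End first_integrals.

(** * Behaviour of the first integrals under a change of units *)

Section units.
Context {R : realType}.
Implicit Types (U : R -> R) (D : set (phase R)).
Variables l s : R.
Hypothesis l0 : 0 < l.
Hypothesis s0 : 0 < s.

Let ln0 : l != 0. Proof. by rewrite gt_eqF. Qed.
Let sn0 : s != 0. Proof. by rewrite gt_eqF. Qed.

Lemma rescale_pointK : cancel (rescale_point l s) (rescale_point l^-1 s^-1).
Proof.
move=> [[[[t r] th] v] w] /=.
by congr (_, _, _, _, _); field; rewrite ?ln0 ?sn0.
Qed.

Lemma I1_rescale_point (x : phase R) :
  I1 (rescale_point l s x) = l ^+ 2 / s * I1 x.
Proof. by case: x => [[[[t r] th] v] w] /=; field. Qed.

Lemma I2_rescale_point U (x : phase R) : x.1.1.1.2 != 0 ->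
  I2 (rescale_potential l s U) (rescale_point l s x) = (l / s) ^+ 2 * I2 U x.
Proof.
case: x => [[[[t r] th] v] w] /= r0; rewrite /rescale_potential.
have -> : l * r / l = r by field.
by field; rewrite ln0 sn0 r0.
Qed.

Lemma sg_rescale_speed (v : R) : Num.sg (l / s * v) = Num.sg v.
Proof. by rewrite sgrM gtr0_sg ?mul1r// divr_gt0. Qed.

(** Change of variable in the integral: [k] is the scaling factor of the antiderivative, and the
    integrand scales by [k / l] because dr scales by [l]. The new antiderivative first converts its
    arguments back to the old units. *)
Lemma indefinite_integral_rescale U D (k : R) (g h : R -> R -> R -> R -> R)
    (G : R -> R -> R -> R) :
  regular_domain U D ->
  (forall sg c1 c2 r, 0 < r ->
     h sg (l ^+ 2 / s * c1) ((l / s) ^+ 2 * c2) (l * r) = k / l * g sg c1 c2 r) ->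
  indefinite_integral U D g G ->
  indefinite_integral (rescale_potential l s U) (rescale_point l s @` D) h
    (fun c1 c2 r => k * G (s / l ^+ 2 * c1) ((s / l) ^+ 2 * c2) (r / l)).
Proof.
move=> [_ regD] gh GP t r th v w [[[[[t' r'] th'] v'] w'] Dy yx].
have [r0 v0 dU] := regD _ _ _ _ _ Dy.
set y := (t', r', th', v', w') in Dy yx.
rewrite -yx I1_rescale_point I2_rescale_point ?gt_eqF// -/y.
case: yx => _ <- _ <- _; rewrite sg_rescale_speed => c1 c2; rewrite gh// {}/c1 {}/c2.
have e1 : s / l ^+ 2 * (l ^+ 2 / s * I1 y) = I1 y by field; rewrite ln0 sn0.
have e2 : (s / l) ^+ 2 * ((l / s) ^+ 2 * I2 U y) = I2 U y.
  by field; rewrite ln0 sn0.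
have er : l * r' / l = r' by field.
rewrite e1 e2.
have dG : is_derive r' 1 (G (I1 y) (I2 U y)) _ := GP _ _ _ _ _ Dy.
rewrite -{1}er in dG.
have dl : is_derive (l * r') 1 (fun z : R => z / l) l^-1.
  have := is_deriveZ l^-1 (is_derive_id (l * r') 1).
  rewrite [_ *: 1]mulr1; congr (is_derive _ _ _ _).
  by apply/funext => z; rewrite /= [LHS]mulrC.
have dk := is_deriveZ k (is_derive1_comp (g := fun z : R => z / l) dG dl).
apply: (is_derive_eq dk).
by rewrite /GRing.scale /=; ring.
Qed.

(** The radicand scales by [(l ^+ 3 / s) ^+ 2]; the resulting factor is written as [k / l] with
    [k = s / l ^+ 2]. *)
Lemma integrand3_rescale U (sg c1 c2 r : R) : 0 < r ->
  integrand3 (rescale_potential l s U) sg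
    (l ^+ 2 / s * c1) ((l / s) ^+ 2 * c2) (l * r) =
  s / l ^+ 2 / l * integrand3 U sg c1 c2 r.
Proof.
move=> r0; rewrite /integrand3 /rescale_potential.
have -> : l * r / l = r by field.
have -> : 2 * ((l / s) ^+ 2 * c2 - (l / s) ^+ 2 * U r) * (l * r) ^+ 4
    - (l ^+ 2 / s * c1) ^+ 2 * (l * r) ^+ 2 =
    (l ^+ 3 / s) ^+ 2 * (2 * (c2 - U r) * r ^+ 4 - c1 ^+ 2 * r ^+ 2).
  by field.
rewrite sqrtrM ?sqr_ge0// sqrtr_sqr gtr0_norm ?divr_gt0 ?exprn_gt0//.
rewrite invfM invf_div mulrCA; congr (_ * _).
by field.
Qed.

Lemma integrand4_rescale U (sg c1 c2 r : R) : 0 < r ->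
  integrand4 (rescale_potential l s U) sg
    (l ^+ 2 / s * c1) ((l / s) ^+ 2 * c2) (l * r) =
  s / l * integrand4 U sg c1 c2 r.
Proof.
move=> r0; rewrite /integrand4 /rescale_potential.
have rn0 : r != 0 by rewrite gt_eqF.
have -> : l * r / l = r by field.
have -> : 2 * ((l / s) ^+ 2 * c2 - (l / s) ^+ 2 * U r)
    - (l ^+ 2 / s * c1) ^+ 2 * (l * r) ^- 2 =
    (l / s) ^+ 2 * (2 * (c2 - U r) - c1 ^+ 2 * r ^- 2).
  by field; rewrite ln0 sn0 rn0.
rewrite sqrtrM ?sqr_ge0// sqrtr_sqr gtr0_norm ?divr_gt0//.
by rewrite invfM invf_div mulrCA.
Qed.

End units.

Lemma angular_momentum_units {R : realType} :
  has_units angular_momentum_unit (@is_I1 R).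
Proof.
move=> l s U D J l0 s0 _ JP _ [y Dy <-].
by rewrite rescale_pointK// JP// I1_rescale_point// exprN1.
Qed.

Lemma energy_units {R : realType} : has_units energy_unit (@is_I2 R).
Proof.
move=> l s U D J l0 s0 regD JP _ [[[[[t r] th] v] w] Dy <-].
have [r0 _ _] := regD.2 _ _ _ _ _ Dy.
rewrite rescale_pointK// JP// I2_rescale_point ?gt_eqF//.
by congr (_ * _); rewrite expr_div_n.
Qed.

(** The antiderivative scales by [s / l ^+ 2], the inverse of the factor of [I1], so their product
    is a pure number like theta. *)
Lemma radian_units {R : realType} : has_units radian_unit (@is_I3 R).
Proof.
move=> l s U D J l0 s0 regD [G GP JP].
have [ln0 sn0] : l != 0 /\ s != 0 by rewrite !gt_eqF.
exists (fun c1 c2 r =>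
    s / l ^+ 2 * G (s / l ^+ 2 * c1) ((s / l) ^+ 2 * c2) (r / l)).
  apply: indefinite_integral_rescale regD _ GP => // sg c1 c2 r r0.
  by rewrite integrand3_rescale.
move=> t r th v w [[[[[t' r'] th'] v'] w'] Dy yx] x.
have [r0 _ _] := regD.2 _ _ _ _ _ Dy.
set y := (t', r', th', v', w') in Dy yx.
rewrite /x -yx rescale_pointK// (JP _ _ _ _ _ Dy) -/y.
rewrite I1_rescale_point// I2_rescale_point ?gt_eqF//.
case: yx => _ <- <- _ _.
have -> : s / l ^+ 2 * (l ^+ 2 / s * I1 y) = I1 y by field; rewrite ln0 sn0.
have -> : (s / l) ^+ 2 * ((l / s) ^+ 2 * I2 U y) = I2 U y.
  by field; rewrite ln0 sn0.
have -> : l * r' / l = r' by field.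
by rewrite !expr0z; field; rewrite ln0 sn0.
Qed.

(** Here the integrand is an inverse speed, with factor [s / l], so its antiderivative in r scales
    by [s], as t does. *)
Lemma time_units {R : realType} : has_units time_unit (@is_I4 R).
Proof.
move=> l s U D J l0 s0 regD [G GP JP].
have [ln0 sn0] : l != 0 /\ s != 0 by rewrite !gt_eqF.
exists (fun c1 c2 r => s * G (s / l ^+ 2 * c1) ((s / l) ^+ 2 * c2) (r / l)).
  apply: indefinite_integral_rescale regD _ GP => // sg c1 c2 r r0.
  by rewrite integrand4_rescale.
move=> t r th v w [[[[[t' r'] th'] v'] w'] Dy yx] x.
have [r0 _ _] := regD.2 _ _ _ _ _ Dy.
set y := (t', r', th', v', w') in Dy yx.
rewrite /x -yx rescale_pointK// (JP _ _ _ _ _ Dy) -/y.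
rewrite I1_rescale_point// I2_rescale_point ?gt_eqF//.
case: yx => <- <- _ _ _.
have -> : s / l ^+ 2 * (l ^+ 2 / s * I1 y) = I1 y by field; rewrite ln0 sn0.
have -> : (s / l) ^+ 2 * ((l / s) ^+ 2 * I2 U y) = I2 U y.
  by field; rewrite ln0 sn0.
have -> : l * r' / l = r' by field.
by rewrite expr0z expr1z mul1r mulrBr.
Qed.

Theorem proposition1 (R : realType) :
  (forall (U : R -> R) (D : set (phase R)) (I3 I4 : phase R -> R),
     regular_domain U D ->
     is_I3 U D I3 -> differentiable_on D I3 ->
     is_I4 U D I4 -> differentiable_on D I4 ->
     connected_level_sets U D I3 I4 ->
     forall I : phase R -> R,
       solves_determining_equation U D I <->
       exists f : R * R * R * R -> R,
         (forall x, D x -> differentiable f (I1 x, I2 U x, I3 x, I4 x)) /\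
         (forall x, D x -> I x = f (I1 x, I2 U x, I3 x, I4 x)))
  /\ has_units angular_momentum_unit (@is_I1 R)
  /\ has_units energy_unit (@is_I2 R)
  /\ has_units radian_unit (@is_I3 R)
  /\ has_units time_unit (@is_I4 R).
Proof.
split; last first.
  split; first exact: angular_momentum_units.
  split; first exact: energy_units.
  by split; [exact: radian_units|exact: time_units].
move=> U D I3 I4 regD [G3 G3P I3P] dI3 [G4 G4P I4P] dI4 conn I.
exact: (general_solution U D I3 I4 G3 G4 regD G3P G4P I3P I4P I dI3 dI4 conn).
Qed.
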